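(* Let $\lambda=(a,1^b)$ be a hook shape ($a\ge1$, $b\ge0$). Then, as operators on $\mathbf F$, \[ s_\lambda(\mathbf u)=\sum_T u_{\mathrm{reading}(T)}, \] where the sum is over all fillings $T$ of the boxes of $\lambda$ by integers (of any sign) which are strictly increasing from left to right along the first row and strictly increasing from top to bottom down the first column.
   Context: Fix an integer $n\ge 1$. Partitions are drawn in English notation; the box in row $r$ and column $c$ lies on diagonal $c-r$. An $n$-ribbon is a connected skew shape with $n$ boxes containing no $2\times 2$ square; its head is its top-right box, and its spin is its number of rows minus $1$. Let $K=\mathbb{C}(q)$ and let $\mathbf F$ be the $K$-vector space with basis the set of all partitions. For $i\in\mathbb{Z}$, $u_i\in\mathrm{End}_K(\mathbf F)$ is defined by $u_i(\lambda)=q^{\mathrm{spin}(\mu/\lambda)}\mu$ if there is a partition $\mu$ with $\mu/\lambda$ an $n$-ribbon with head on diagonal $i$, else $0$. Let $h_k(\mathbf u)=\sum_{i_1<\cdots<i_k}u_{i_k}\cdots u_{i_1}$, $h_0(\mathbf u)=1$, $h_k(\mathbf u)=0$ for $k<0$; these operators pairwise commute, and $s_\lambda(\mathbf u)=\det\big(h_{\lambda_i-i+j}(\mathbf u)\big)_{i,j=1}^{\ell(\lambda)}$. The reading word $\mathrm{reading}(T)$ of a filling $T$ is obtained by reading the top row from right to left, then each subsequent row from right to left, going downwards; for a word $w=w_1w_2\cdots w_k$ set $u_w=u_{w_1}u_{w_2}\cdots u_{w_k}$. Infinite sums of operators here are well defined since only finitely many terms act nontrivially on a given partition. *)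

(* Defs.v *)
From HB Require Import structures.
From mathcomp Require Import all_boot all_order all_algebra.
From mathcomp Require Import finmap complex.
From mathcomp Require Import boolp classical_sets cardinality fsbigop reals.
From mathcomp Require Import monalg zify.

Set Implicit Arguments.
Unset Strict Implicit.
Unset Printing Implicit Defensive.

Import Order.TTheory GRing.Theory Num.Theory.

Local Open Scope ring_scope.
Local Open Scope complex_scope.

Definition is_intpart (s : seq nat) : bool := sorted geq s && (0%N \notin s).

Record intpart :=
  Intpart { parts :> seq nat; partsP : is_intpart parts }.

HB.instance Definition _ := [isSub for parts].
HB.instance Definition _ := [Choice of intpart by <:].

(* A box is a pair (row, column), both counted from 0 (English notation), so   *)
(* that its diagonal c - r does not depend on whether one counts from 0 or 1.  *)
Definition box : Type := (nat * nat)%type.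

Definition boxes (lam : seq nat) : {fset box} :=
  [fset x in [seq (r, c) | r <- iota 0 (size lam), c <- iota 0 (nth 0%N lam r)]]%fset.

Lemma mem_boxes (lam : seq nat) (x : box) :
  (x \in boxes lam) = (x.2 < nth 0%N lam x.1)%N.
Proof.
rewrite in_fset /=; apply/allpairsPdep/idP => [[r [c [_ + ->]]]|x_lam].
  by rewrite mem_iota.
case: x => r c /= in x_lam *; exists r, c; rewrite !mem_iota /= !add0n; split => //.
by case: ltnP => // le_r; rewrite nth_default in x_lam.
Qed.

Lemma nth_antimono (lam : intpart) i j : (i <= j)%N -> (nth 0%N lam j <= nth 0%N lam i)%N.
Proof.
move=> le_ij; case: lam => s /= /andP[ss _].
case: (ltnP j (size s)) => [lt_j|le_s]; last by rewrite (nth_default _ le_s).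
have tr : transitive geq by move=> a b c /= ab bc; exact: leq_trans bc ab.
have := @sorted_leq_nth _ geq tr (fun x => leqnn x) 0%N s ss i j.
by apply => //; rewrite inE //; exact: leq_ltn_trans le_ij lt_j.
Qed.

Lemma box_bound (lam : intpart) (x : box) : x \in boxes lam ->
  (x.1 < #|` boxes lam|)%N /\ (x.2 < #|` boxes lam|)%N.
Proof.
rewrite mem_boxes; case: x => r c /= lt_c; split.
  have sub : ([fset x in [seq (i, 0%N) | i <- iota 0 r.+1]] `<=` boxes lam)%fset.
    apply/fsubsetP => y; rewrite in_fset; case/seq.mapP=> j; rewrite mem_iota => /andP[_ lt_i] ->.
    rewrite mem_boxes /=; apply: leq_trans (nth_antimono lam (_ : j <= r)%N); lia.
  move: (fsubset_leq_card sub); rewrite card_fseq undup_id ?size_map ?size_iota //.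
  by rewrite map_inj_uniq ?iota_uniq // => i j [].
have sub : ([fset x in [seq (r, i) | i <- iota 0 c.+1]] `<=` boxes lam)%fset.
  apply/fsubsetP => y; rewrite in_fset; case/seq.mapP=> j; rewrite mem_iota => /andP[_ lt_i] ->.
  rewrite mem_boxes /=; lia.
move: (fsubset_leq_card sub); rewrite card_fseq undup_id ?size_map ?size_iota //.
by rewrite map_inj_uniq ?iota_uniq // => i j [].
Qed.

Definition skew_shape (lam mu : seq nat) : {fset box} := (boxes mu `\` boxes lam)%fset.

Definition box_diagonal (x : box) : int := x.2%:Z - x.1%:Z.

Definition adjacent (x y : box) : bool :=
  ((x.1 == y.1) && ((x.2 == y.2.+1) || (y.2 == x.2.+1)))
  || ((x.2 == y.2) && ((x.1 == y.1.+1) || (y.1 == x.1.+1))).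

Definition connected_boxes (S : {fset box}) : Prop :=
  forall x y : S, connect (fun a b : S => adjacent (val a) (val b)) x y.

Definition has_2x2 (S : {fset box}) : Prop :=
  exists r c : nat,
    [/\ (r, c) \in S, (r, c.+1) \in S, (r.+1, c) \in S & (r.+1, c.+1) \in S].

Definition is_ribbon (n : nat) (lam mu : intpart) : Prop :=
  [/\ (boxes lam `<=` boxes mu)%fset,
      connected_boxes (skew_shape lam mu),
      #|` skew_shape lam mu| = n
    & ~ has_2x2 (skew_shape lam mu)].

Definition is_head (S : {fset box}) (x : box) : Prop :=
  x \in S /\ forall y, y \in S -> (x.1 <= y.1)%N /\ (y.2 <= x.2)%N.

Definition spin (S : {fset box}) : nat := #|` [fset x.1 | x in S]%fset|.-1.

Definition adds_ribbon (n : nat) (i : int) (lam mu : intpart) : Prop :=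
  is_ribbon n lam mu /\
  exists x : box, is_head (skew_shape lam mu) x /\ box_diagonal x = i.

Section LinearEndomorphisms.
Variables (K : pzRingType) (V : lmodType K).

Definition lend : Type := {linear V -> V}.

HB.instance Definition _ := gen_eqMixin lend.
HB.instance Definition _ := gen_choiceMixin lend.

Implicit Types f g h : lend.

Lemma lendP f g : (forall v, f v = g v) -> f = g.
Proof.
case: f g => [f [[fD] [fZ]]] [g [[gD] [gZ]]] /= /funext fg; subst g.
by rewrite (Prop_irrelevance fD gD) (Prop_irrelevance fZ gZ).
Qed.

Definition lend0 : lend := (\0 : V -> V).
Definition lend_opp f : lend := ((\- f) : V -> V).
Definition lend_add f g : lend := (f \+ g : V -> V).
Definition lend1 : lend := (@idfun V).
Definition lend_mul f g : lend := (f \o g).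

Fact lend_addA : associative lend_add.
Proof. by move=> f g h; apply: lendP => v /=; rewrite addrA. Qed.
Fact lend_addC : commutative lend_add.
Proof. by move=> f g; apply: lendP => v /=; rewrite addrC. Qed.
Fact lend_add0 : left_id lend0 lend_add.
Proof. by move=> f; apply: lendP => v /=; rewrite add0r. Qed.
Fact lend_addN : left_inverse lend0 lend_opp lend_add.
Proof. by move=> f; apply: lendP => v /=; rewrite addNr. Qed.

HB.instance Definition _ :=
  GRing.isZmodule.Build lend lend_addA lend_addC lend_add0 lend_addN.

Fact lend_mulA : associative lend_mul.
Proof. by move=> f g h; apply: lendP. Qed.
Fact lend_mul1l : left_id lend1 lend_mul.
Proof. by move=> f; apply: lendP. Qed.
Fact lend_mul1r : right_id lend1 lend_mul.
Proof. by move=> f; apply: lendP. Qed.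
Fact lend_mulDl : left_distributive lend_mul lend_add.
Proof. by move=> f g h; apply: lendP. Qed.
Fact lend_mulDr : right_distributive lend_mul lend_add.
Proof. by move=> f g h; apply: lendP => v /=; rewrite linearD. Qed.

(* The product is composition: (f * g) v = f (g v). *)
HB.instance Definition _ := GRing.Zmodule_isPzRing.Build lend
  lend_mulA lend_mul1l lend_mul1r lend_mulDl lend_mulDr.

End LinearEndomorphisms.

Section Fock.
Variable R : realType.

Definition Kq : fieldType := {fraction {poly R[i]}}.

Definition qvar : Kq := tofrac 'X.

Definition Fock : lmodType Kq := {malg Kq[intpart]}.

Definition FockEnd : pzRingType := lend Fock.

Definition ket (lam : intpart) : Fock := (<< lam >> : {malg Kq[intpart]}).

Definition lin_ext_fun (f : intpart -> Fock) (v : Fock) : Fock :=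
  \sum_(lam <- msupp (v : {malg Kq[intpart]}))
    mcoeff lam (v : {malg Kq[intpart]}) *: f lam.

Fact lin_ext_is_linear f : linear (lin_ext_fun f).
Proof.
have wide (g : {malg Kq[intpart]}) (D : {fset intpart}) :
    (msupp g `<=` D)%fset -> lin_ext_fun f g = \sum_(lam <- D) g@_lam *: f lam.
  move=> sgD; rewrite /lin_ext_fun (big_fset_incl _ sgD) //= => lam _.
  by move/mcoeff_outdom => ->; rewrite scale0r.
move=> a x y /=; set D := (msupp (x : {malg _[_]}) `|` msupp (y : {malg _[_]})
  `|` msupp (a *: x + y : {malg Kq[intpart]}))%fset.
have sxD : (msupp (x : {malg _[_]}) `<=` D)%fset.
  by rewrite /D -fsetUA fsubsetUl.
have syD : (msupp (y : {malg _[_]}) `<=` D)%fset.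
  by rewrite /D -fsetUA fsubsetU // fsubsetUl orbT.
rewrite (wide _ D (fsubsetUr _ _)) (wide _ D sxD) (wide _ D syD).
rewrite scaler_sumr -big_split /=; apply: eq_bigr => lam _.
by rewrite mcoeffD mcoeffZ scalerDl scalerA.
Qed.

HB.instance Definition _ f := GRing.isLinear.Build Kq Fock Fock *:%R
  (lin_ext_fun f) (lin_ext_is_linear f).

(* The endomorphism with prescribed values on the basis of partitions *)
Definition lin_ext (f : intpart -> Fock) : FockEnd :=
  (lin_ext_fun f : {linear Fock -> Fock}).

Lemma lin_ext_ket f lam : lin_ext f (ket lam) = f lam.
Proof.
rewrite /= /lin_ext_fun /ket msuppU oner_eq0 big_seq_fset1 mcoeffUU.
by rewrite scale1r.
Qed.

Variable n : nat.

(* There is at most one such mu, so the choice made by cid is immaterial. *)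
Definition u_ket (i : int) (lam : intpart) : Fock :=
  if pselect (exists mu, adds_ribbon n i lam mu) is left ex_mu then
    let mu := sval (cid ex_mu) in qvar ^+ spin (skew_shape lam mu) *: ket mu
  else 0.

Definition u_op (i : int) : FockEnd := lin_ext (u_ket i).

Definition u_word (w : seq int) : FockEnd := \prod_(i <- w) u_op i.

(* The words of a given length that do not annihilate a given partition are    *)
(* finite in number: u_word w increases the number of boxes by n * size w, and *)
(* the diagonal of a box of lam is less than the number of boxes of lam.       *)

Lemma u_ketP i lam : u_ket i lam = 0 \/
  exists c mu, [/\ u_ket i lam = c *: ket mu,
     #|` boxes mu| = (#|` boxes lam| + n)%N & (`|i| <= #|` boxes lam| + n)%N].
Proof.
rewrite /u_ket; case: pselect => [ex|]; last by left.
right; case: cid => mu /= [[sub _ cn _] [x [[xs _] <-]]].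
exists (qvar ^+ spin (skew_shape lam mu)), mu.
have E : #|` boxes mu| = (#|` boxes lam| + n)%N.
  by rewrite -cn /skew_shape cardfsD (fsetIidPr sub) subnKC // fsubset_leq_card.
split => //; rewrite -E.
by move: xs; rewrite /skew_shape in_fsetD => /andP[_ /box_bound[]]; rewrite /box_diagonal; move: (#|` boxes mu|) x.1 x.2 => *; lia.
Qed.

Lemma u_wordP w lam : u_word w (ket lam) = 0 \/
  exists c mu, [/\ u_word w (ket lam) = c *: ket mu,
     #|` boxes mu| = (#|` boxes lam| + n * size w)%N &
     all (fun i : int => `|i| <= #|` boxes lam| + n * size w)%N w].
Proof.
elim: w => [|i w IH].
  right; exists 1, lam; rewrite muln0 addn0 /u_word big_nil scale1r; split => //.
have -> : u_word (i :: w) (ket lam) = u_op i (u_word w (ket lam)).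
  by rewrite /u_word big_cons.
case: IH => [->|[c [mu [-> E A]]]]; first by left; rewrite linear0.
rewrite linearZ /u_op lin_ext_ket.
case: (u_ketP i mu) => [->|[c' [nu [-> E' A']]]]; first by left; exact: scaler0.
right; exists (c * c'), nu; split; [exact: scalerA| |]; first by rewrite E' E /= mulnS [(n + _)%N]addnC addnA.
rewrite /= mulnS; move: A' A; rewrite E; move: #|` boxes lam| (n * size w)%N => a b A' A.
apply/andP; split; first by apply: leq_trans A' _; rewrite -addnA leq_add2l addnC.
by apply: sub_all A => j jb; apply: leq_trans jb _; rewrite leq_add2l leq_addl.
Qed.

Lemma finite_words k lam :
  finite_set [set w : seq int | size w = k /\ u_word w (ket lam) <> 0]%classic.
Proof.
set B := (#|` boxes lam| + n * k)%N.
apply: (@sub_finite_set _ _ ((fun t : k.-tuple 'I_(B + B).+1 => [seq (val i)%:Z - B%:Z | i <- t]) @` setT)).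
  move=> w [sw nz]; case: (u_wordP w lam) => // -[c [mu [_ _]]]; rewrite sw -/B => /allP A.
  have sz : size [seq (inord `|i + B%:Z| : 'I_(B + B).+1) | i <- w] == k by rewrite size_map sw.
  exists (Tuple sz) => //=; rewrite -map_comp -[RHS]map_id; apply/eq_in_map => i /A Ai /=.
  by rewrite inordK; lia.
by apply: finite_image; exact: finite_finset.
Qed.
(* A possibly infinite sum of operators of which only finitely many do not     *)
(* vanish on any given partition: the sum is computed on each basis vector,    *)
(* by a finitely supported sum.                                                *)
Definition op_sum (T : choiceType) (A : set T) (F : T -> FockEnd) : FockEnd :=
  lin_ext (fun lam => \sum_(t \in A) (F t (ket lam))).

Definition h_op (k : int) : FockEnd :=
  if k is Posz m then
    op_sum [set s : seq int | size s = m /\ sorted <%R s]%classic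
      (fun s => u_word (rev s))
  else 0.

(* Row and column indices are counted from 0, which leaves lam_i - i + j as    *)
(* it is. The h's commute, so the order of the factors, for which \det takes   *)
(* that of the rows, is immaterial.                                            *)
Definition schur_op (lam : intpart) : FockEnd :=
  \det (\matrix_(i < size lam, j < size lam)
          h_op ((nth 0%N lam i)%:Z - i%:Z + j%:Z)).

End Fock.

(* A filling is the sequence of its rows, from top to bottom. *)
Definition filling : choiceType := seq (seq int).

Definition hook_filling (lam : intpart) (T : filling) : Prop :=
  [/\ shape T = lam,
      sorted <%R (head [::] T)
    & sorted <%R [seq head 0 row | row <- T]].

Definition reading (T : filling) : seq int := flatten [seq rev row | row <- T].

(* Main.v *)
Require Import Defs.
From mathcomp Require Import all_boot all_order all_algebra perm.
From mathcomp Require Import finmap boolp functions cardinality fsbigop monalg.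
From mathcomp Require Import classical_sets reals.
From mathcomp Require Import zify.

(** Let R(a, b) be the right-hand side for the hook (a, 1^b): the sum of u_w over
the words w of length a + b whose first a letters decrease and whose letters
from the a-th on increase. A product of a decreasing word of length a and an
increasing word of length b + 1 satisfies one of: the a-th letter is smaller
than the next one (a word of R(a, b + 1)), larger (a word of R(a + 1, b)), or
equal, in which case the product vanishes because u_i^2 = 0. Hence
h_a R(1, b) = R(a, b + 1) + R(a + 1, b). Expanding the Jacobi-Trudi determinant
along its first row gives the same recursion for s_(a, 1^b), without using that
the h_k commute. *)

Set Implicit Arguments.
Unset Strict Implicit.
Unset Printing Implicit Defensive.

Import Order.TTheory GRing.Theory Num.Theory.

Local Open Scope classical_set_scope.
Local Open Scope ring_scope.

(** * Laplace expansion over a noncommutative ring *)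

Lemma lift_perm_inj m (i j : 'I_m.+1) : injective (lift_perm i j).
Proof.
move=> s t st; apply/permP => k; apply: (@lift_inj _ j).
by rewrite -!(lift_perm_lift i) st.
Qed.

(** With [lift_perm_inj], this identifies the permutations sending [ord0] to a given column with the
    permutations of the remaining rows and columns, which reindexes the Leibniz sum. *)
Lemma lift_perm_surj m (s : 'S_m.+1) : exists t, s = lift_perm ord0 (s ord0) t.
Proof.
have [t tE] : exists t : 'I_m -> 'I_m, forall k, lift (s ord0) (t k) = s (lift ord0 k).
  exists (fun k => odflt k (unlift (s ord0) (s (lift ord0 k)))) => k.
  have s0k : s ord0 != s (lift ord0 k) by rewrite (inj_eq perm_inj) neq_lift.
  by have [l sk ->] := unlift_some s0k.
have t_inj : injective t.
  by move=> k l tkl; apply: (@lift_inj _ ord0); apply: (@perm_inj _ s); rewrite -!tE tkl.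
exists (perm t_inj); apply/permP => k.
by case: (unliftP ord0 k) => [l|] ->; rewrite ?lift_perm_id // lift_perm_lift permE tE.
Qed.

Section NoncommutativeDeterminant.
Variable P : pzRingType.

Lemma prodr_eq0 (I : eqType) (r : seq I) (F : I -> P) i :
  i \in r -> F i = 0 -> \prod_(j <- r) F j = 0.
Proof.
move=> + Fi0; elim: r => //= j r IH; rewrite inE big_cons.
by case/orP=> [/eqP <-|/IH ->]; rewrite ?Fi0 ?mul0r ?mulr0.
Qed.

Lemma det_col0 m (A : 'M[P]_m) j : (forall i, A i j = 0) -> \det A = 0.
Proof.
move=> A0; rewrite /(\det A) big1 // => s _.
rewrite (@prodr_eq0 _ _ _ (s^-1%g j)) ?mulr0 ?mem_index_enum //.
by rewrite permKV.
Qed.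

(* Entries need not commute: [\det] multiplies them in the order of the rows, so
   an entry of the first row factors out on the left. *)
Lemma expand_det_row0 m (A : 'M[P]_m.+1) :
  \det A = \sum_j A ord0 j * cofactor A ord0 j.
Proof.
rewrite /(\det A) (partition_big (fun s : 'S_m.+1 => s ord0) predT) //=.
apply: eq_bigr => j0 _; rewrite (reindex (lift_perm ord0 j0)); last first.
  exists (fun s => odflt 1%g [pick t | lift_perm ord0 j0 t == s]) => [t _|s /eqP s0].
    by case: pickP => [t' /eqP/lift_perm_inj|/(_ t)]; last rewrite eqxx.
  have [t sE] := lift_perm_surj s; rewrite s0 in sE.
  by case: pickP => [t' /eqP //|/(_ t)]; rewrite -sE eqxx.
rewrite /cofactor !big_distrr /=.
apply: eq_big => [s | s _]; first by rewrite lift_perm_id eqxx.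
(* Signs are the only factors moved past matrix entries. *)
have signCA k (y : P) : (-1) ^+ k * (A ord0 j0 * y) = A ord0 j0 * ((-1) ^+ k * y).
  by rewrite !mulrA (commr_sign _ k).
rewrite big_ord_recl lift_perm_id odd_lift_perm.
have -> : \prod_(i < m) A (lift ord0 i) (lift_perm ord0 j0 s (lift ord0 i))
    = \prod_(i < m) row' ord0 (col' j0 A) i (s i).
  by apply: eq_bigr => i _; rewrite !mxE lift_perm_lift.
move: (odd_perm s) => b.
by rewrite !signr_addb signr_odd mul1r signr_odd -mulrA !signCA.
Qed.

(** In the expansion along the first row, every minor but the first keeps column [ord0] of [A],
    whose remaining entries are 0. *)
Lemma det_unit_col0 m (A : 'M[P]_m.+1) :
    A ord0 ord0 = 1 -> (forall i, A (lift ord0 i) ord0 = 0) ->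
  \det A = \det (row' ord0 (col' ord0 A)).
Proof.
move=> A00 Ai0; rewrite expand_det_row0 big_ord_recl A00 mul1r.
rewrite big1 ?addr0 => [|j _].
  by rewrite /cofactor addn0 expr0 mul1r.
have m_gt0 : (0 < m)%N by apply: leq_ltn_trans (ltn_ord j).
rewrite /cofactor (@det_col0 _ _ (Ordinal m_gt0)) ?mulr0 // => i; rewrite !mxE.
rewrite (_ : lift _ (Ordinal _) = ord0) ?Ai0 //; exact: val_inj.
Qed.

(** For [f j = h (a + j)] this is the Jacobi-Trudi matrix of (a, 1^m). Leaving the first row free
    makes the family closed under expansion, which shifts [f]. *)
Definition jacobi_trudi_hook (h : int -> P) (f : nat -> P) m : 'M[P]_m.+1 :=
  \matrix_(i, j) if i == ord0 then f j else h (1 - i%:Z + j%:Z).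

Lemma det_jacobi_trudi_hook0 (h : int -> P) (f : nat -> P) :
  \det (jacobi_trudi_hook h f 0) = f 0%N.
Proof.
rewrite /(\det _) (big_pred1 (1%g : 'S_1)) => [|s]; last by rewrite [s]permS1 /= eqxx.
by rewrite odd_perm1 mul1r big_ord1 perm1 mxE eqxx.
Qed.

(** Below the first row, column 0 is [h 0 = 1] followed by zeros. Deleting it with the first row
    leaves a matrix of the same family; every other minor reduces by [det_unit_col0] to a minor of
    the matrix for [f \o S], with the opposite sign. *)
Lemma det_jacobi_trudi_hookS (h : int -> P) (f : nat -> P) m :
    h 0 = 1 -> (forall k, k < 0 -> h k = 0) ->
  \det (jacobi_trudi_hook h f m.+1) =
    f 0%N * \det (jacobi_trudi_hook h (fun j => h j.+1) m)
    - \det (jacobi_trudi_hook h (f \o S) m).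
Proof.
move=> h0 hneg; rewrite expand_det_row0 big_ord_recl mxE eqxx; congr (_ * _ + _).
  rewrite /cofactor expr0 mul1r; congr (\det _); apply/matrixP=> i j; rewrite !mxE.
  rewrite -(inj_eq val_inj) /= /bump leq0n; case: eqVneq => [->|_].
    by rewrite add1n; congr h; lia.
  by congr h; lia.
rewrite expand_det_row0 -sumrN; apply: eq_bigr => j _.
rewrite !mxE !eqxx -mulrN; congr (_ * _).
rewrite /cofactor !add0n lift0 exprS mulN1r mulNr; congr (- (_ * _)).
(* Column 0 lies to the left of the deleted column, so it is still the first column of the minor. *)
have lift_j0 : lift (lift ord0 j) ord0 = ord0 :> 'I_m.+2 by exact: val_inj.
rewrite det_unit_col0.
- congr (\det _); apply/matrixP=> i k; rewrite !mxE /=.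
  congr h. rewrite /= /bump /=. lia.
- rewrite !mxE lift_j0 /= -h0; congr h; lia.
- move=> i; rewrite !mxE lift_j0 /= hneg //; lia.
Qed.
End NoncommutativeDeterminant.

(** * Action of the ribbon operators on the Fock space *)

Section RibbonOperators.
Variables (R : realType) (n : nat).
Implicit Types (lam mu nu : intpart) (A B : set (seq int)).

Lemma FockEnd_ext (f g : FockEnd R) :
  (forall lam, f (ket R lam) = g (ket R lam)) -> f = g.
Proof.
move=> fg; apply: lendP => v.
have -> : v = \sum_(lam <- msupp (v : {malg (Kq R)[intpart]}))
    mcoeff lam (v : {malg (Kq R)[intpart]}) *: ket R lam.
  rewrite [LHS]monalgE; apply: eq_bigr => lam _.
  by apply/malgP => mu; rewrite mcoeffZ !mcoeffU mulr_natr.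
by rewrite !linear_sum; apply: eq_bigr => lam _; rewrite !linearZ fg.
Qed.

(* With [(r, c)] the head of the first ribbon, the box [(r, c.+1)] would belong
   to the second ribbon although it lies strictly above its head. *)
Lemma adds_ribbon_twice i lam mu nu :
  adds_ribbon n i lam mu -> ~ adds_ribbon n i mu nu.
Proof.
move=> [_ [[r c] [[xS xtop] <-]]] [_ [[r' c'] [[yS ytop]]]].
move: xS yS; rewrite /skew_shape !in_fsetD !mem_boxes /box_diagonal /= -!leqNgt.
move=> /andP[lam_r mu_r] /andP[mu_r' nu_r'] diag.
have lt_r : (r < r')%N.
  rewrite ltnNge; apply/negP => le_r'.
  have := nth_antimono mu le_r'; lia.
have mu_rc : (nth 0%N mu r <= c.+1)%N.
  rewrite leqNgt; apply/negP => lt_mu.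
  have /xtop[_ /=] : (r, c.+1) \in skew_shape lam mu.
    by rewrite in_fsetD !mem_boxes /= -leqNgt lt_mu (leq_trans lam_r).
  by rewrite ltnn.
have /ytop[/= le_r' _] : (r, c.+1) \in skew_shape mu nu.
  rewrite in_fsetD !mem_boxes /= -leqNgt mu_rc /=.
  have := nth_antimono nu (ltnW lt_r); lia.
by rewrite leqNgt lt_r in le_r'.
Qed.

Lemma u_op_sq i : u_op R n i * u_op R n i = 0.
Proof.
apply: FockEnd_ext => lam; change (u_op R n i (u_op R n i (ket R lam)) = 0).
rewrite /u_op lin_ext_ket {2}/u_ket; case: pselect => [ex|_]; last exact: linear0.
rewrite linearZ lin_ext_ket /u_ket; case: pselect => [[nu mu_nu]|_]; last exact: scaler0.
by case: (adds_ribbon_twice (svalP (cid ex)) mu_nu).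
Qed.

Lemma u_word_cat v w : u_word R n (v ++ w) = u_word R n v * u_word R n w.
Proof. by rewrite /u_word big_cat. Qed.

Lemma u_word_sq v i w : u_word R n (v ++ [:: i, i & w]) = 0.
Proof.
by rewrite u_word_cat {2}/u_word !big_cons (mulrA (u_op R n i)) u_op_sq mul0r mulr0.
Qed.

(** * Locally finite sums of operators *)

Lemma op_sum_ket (T : choiceType) (A : set T) F lam :
  op_sum A F (ket R lam) = \sum_(t \in A) F t (ket R lam).
Proof. by rewrite /op_sum lin_ext_ket. Qed.

Lemma reindex_op_sum (T U : choiceType) (A : set T) (B : set U) g F :
  set_bij A B g -> op_sum B F = op_sum A (F \o g) :> FockEnd R.
Proof.
by move=> gAB; apply: FockEnd_ext => lam; rewrite !op_sum_ket (reindex_fsbig g A B _ gAB).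
Qed.

Definition word_sum A : FockEnd R := op_sum A (u_word R n).

Lemma word_sum1 w : word_sum [set w] = u_word R n w.
Proof. by apply: FockEnd_ext => lam; rewrite op_sum_ket fsbig_set1. Qed.

(** A sum over [\in] with infinite support is 0 by convention, so the index set is first cut down to
    one that [finite_words] shows finite; this is where the common length [k] enters. *)
Lemma word_sumE A k lam : (forall w, A w -> size w = k) ->
  word_sum A (ket R lam) =
    \sum_(w \in A `&` [set w | size w = k /\ u_word R n w (ket R lam) <> 0])
      u_word R n w (ket R lam).
Proof.
move=> Ak; rewrite op_sum_ket [LHS]fsbig_supp; apply: eq_fsbigl.
by apply/seteqP; split=> [w /= [Aw nz]|w /= [Aw [_ nz]]]; split; auto.
Qed.

Lemma word_sum_split A A1 A2 k :
    (forall w, A w -> size w = k) -> A1 `<=` A -> A2 `<=` A ->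
    (forall w, A1 w -> ~ A2 w) ->
    (forall w, A w -> ~ A1 w -> ~ A2 w -> u_word R n w = 0) ->
  word_sum A = word_sum A1 + word_sum A2.
Proof.
move=> Ak sA1 sA2 dis van; apply: FockEnd_ext => lam.
change (word_sum A (ket R lam) = word_sum A1 (ket R lam) + word_sum A2 (ket R lam)).
rewrite !(@word_sumE _ k) //; try by move=> w; auto.
set X := [set w | size w = k /\ _]; have finX : finite_set X := finite_words R n k lam.
rewrite -fsbigU0; [|exact: finite_setIr|exact: finite_setIr|]; last first.
  by move=> w [[A1w _] [A2w _]]; exact: dis A1w A2w.
apply: eq_fsbigl; rewrite -setIUl; apply/seteqP; split=> w /= [Aw Xw]; split=> //.
  have [|A1w] := pselect (A1 w); first by left.
  have [|A2w] := pselect (A2 w); first by right.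
  by case: Xw => _; rewrite (van w).
by case: Aw => [/sA1|/sA2].
Qed.

Lemma linear_fsum (T : choiceType) (A : set T) (F : T -> Fock R) (f : FockEnd R) :
  finite_set A -> f (\sum_(t \in A) F t) = \sum_(t \in A) f (F t).
Proof. by move=> finA; rewrite !fsbig_finite // linear_sum. Qed.

(** [op_sum] is defined termwise on basis vectors only. By [u_wordP], words send basis vectors to
    multiples of basis vectors, so this case is enough to compose two sums. *)
Lemma word_sum_scale_ket A k c mu : (forall w, A w -> size w = k) ->
  word_sum A (c *: ket R mu) = \sum_(w \in A) u_word R n w (c *: ket R mu).
Proof.
move=> Ak; rewrite linearZ (word_sumE _ Ak) /=.
set X := A `&` _; have finX : finite_set X by exact: finite_setIr (finite_words R n k mu).
rewrite fsbig_finite // scaler_sumr -fsbig_finite //.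
under eq_fsbigr do rewrite -linearZ.
apply: fsbig_widen => [w []//|w [Aw nX]] /=; rewrite linearZ /=.
have [->|nz] := eqVneq (u_word R n w (ket R mu)) 0; first exact: scaler0.
by case: nX; split=> //; split; [exact: Ak | exact/eqP].
Qed.

Definition cat_words A B : set (seq int) :=
  [set w | exists2 v, A v & exists2 v', B v' & w = v ++ v'].

Lemma word_sumM A B k m :
    (forall w, A w -> size w = k) -> (forall w, B w -> size w = m) ->
  word_sum A * word_sum B = word_sum (cat_words A B).
Proof.
move=> Ak Bm; apply: FockEnd_ext => lam.
change (word_sum A (word_sum B (ket R lam)) = word_sum (cat_words A B) (ket R lam)).
rewrite (word_sumE _ Bm); set Y := B `&` _.
have finY : finite_set Y by exact: finite_setIr (finite_words R n m lam).
rewrite linear_fsum //.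
(* Prefixes of length [k] of the words that do not kill [ket R lam]: one finite set that serves all
   [v] in [Y], so that the two sums can be exchanged. *)
pose X := A `&` take k @` [set w | size w = (k + m)%N /\ u_word R n w (ket R lam) <> 0].
have finX : finite_set X.
  by apply: finite_setIr; apply: finite_image; exact: finite_words.
have -> : \sum_(v \in Y) word_sum A (u_word R n v (ket R lam)) =
    \sum_(v \in Y) \sum_(w \in X) u_word R n (w ++ v) (ket R lam).
  apply: eq_fsbigr => v; rewrite inE => -[Bv _].
  have -> : word_sum A (u_word R n v (ket R lam)) =
      \sum_(w \in A) u_word R n (w ++ v) (ket R lam).
    have [c [mu vE]] : exists c mu, u_word R n v (ket R lam) = c *: ket R mu.
      case: (u_wordP R n v lam) => [->|[c [mu [-> _ _]]]]; last by exists c, mu.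
      by exists 0, lam; rewrite scale0r.
    rewrite vE (word_sum_scale_ket _ _ Ak) -vE.
    by apply: eq_fsbigr => w _; rewrite u_word_cat.
  apply/esym/fsbig_widen => [w []//|w [Aw nX]] /=.
  apply/eqP/negPn/negP => /eqP nz; apply: nX; split=> //=; exists (w ++ v).
    by rewrite size_cat (Ak w) // (Bm v).
  by rewrite take_size_cat // Ak.
rewrite exchange_fsbig // pair_fsbig //.
pose cat2 (p : seq int * seq int) := p.1 ++ p.2.
(* Concatenation is injective here because all words of [A] have length [k]. *)
have cat_bij : set_bij (X `*` Y) (cat2 @` (X `*` Y)) cat2.
  apply: inj_bij => -[w v] [w' v'].
  rewrite !inE /= => -[[Aw _] [Bv _]] [[Aw' _] [Bv' _]] /eqP.
  by rewrite /cat2 /= eqseq_cat ?(Ak w) ?(Ak w') // => /andP[/eqP -> /eqP ->].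
rewrite -(reindex_fsbig cat2 _ _ (fun w => u_word R n w (ket R lam)) cat_bij).
rewrite op_sum_ket; apply: fsbig_widen => [_ [[w v] [[Aw _] [Bv _]] <-]|x].
  by exists w => //; exists v.
move=> [[w Aw [v Bv ->]] nXY] /=; apply/eqP/negPn/negP => /eqP nz; apply: nXY.
have sz : size (w ++ v) = (k + m)%N by rewrite size_cat (Ak w) // (Bm v).
exists (w, v) => //; split; split=> //=.
  by exists (w ++ v) => //; rewrite take_size_cat // Ak.
split; first exact: Bm.
(* [v] acts before [w], so if it kills [ket R lam] then so does [w ++ v]. *)
move=> v0; apply: nz; rewrite u_word_cat.
by change (u_word R n w (u_word R n v (ket R lam)) = 0); rewrite v0 linear0.
Qed.

(** * Hook words and their recursion *)

Definition decreasing_words a : set (seq int) :=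
  [set w | size w = a /\ sorted >%R w].

Definition increasing_words b : set (seq int) :=
  [set w | size w = b /\ sorted <%R w].

(** For positive [a] the two ranges overlap in the letter of index [a.-1], the entry of the corner
    box, which belongs to both the row and the column. *)
Definition hook_words a b : set (seq int) :=
  [set w | [/\ size w = (a + b)%N, sorted >%R (take a w) & sorted <%R (drop a.-1 w)]].

Lemma hook_wordsP a b s (x : int) t : size s = a ->
  hook_words a.+1 b (s ++ x :: t) <->
    [/\ size t = b, sorted >%R (rcons s x) & path <%R x t].
Proof.
move=> <-; rewrite /hook_words /= drop_size_cat // -cat_rcons.
rewrite take_size_cat ?size_rcons // size_cat size_rcons.
by split=> -[st sx px]; split=> //; lia.
Qed.

(** No condition links the junction letters [x] and [y]; comparing them separates the two kinds of
    hook words. *)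
Lemma cat_hook_words a b s (x y : int) t : size s = a ->
  cat_words (decreasing_words a.+1) (increasing_words b.+1) (s ++ [:: x, y & t]) <->
    [/\ size t = b, sorted >%R (rcons s x) & path <%R y t].
Proof.
move=> sa; split=> [[v [sv dv] [v' [sv' dv'] vv']]|[st dx iy]].
  have /eqP : rcons s x ++ y :: t = v ++ v' by rewrite cat_rcons.
  rewrite eqseq_cat ?size_rcons ?sa // => /andP[/eqP -> /eqP yt].
  by move: sv' dv'; rewrite -yt /= => -[].
exists (rcons s x); first by split; rewrite ?size_rcons ?sa.
by exists (y :: t); [split; rewrite //= st | rewrite cat_rcons].
Qed.

Lemma split_nth_word a b (w : seq int) : size w = (a.+1 + b.+1)%N ->
  exists s x y t, size s = a /\ w = s ++ [:: x, y & t].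
Proof.
move=> sw; exists (take a w), (nth 0 w a), (nth 0 w a.+1), (drop a.+2 w).
rewrite size_takel ?sw; last by lia.
by rewrite -!drop_nth ?cat_take_drop // sw; lia.
Qed.

Lemma word_sum_hookS a b :
  word_sum (decreasing_words a.+1) * word_sum (increasing_words b.+1) =
  word_sum (hook_words a.+1 b.+1) + word_sum (hook_words a.+2 b).
Proof.
have Cs w : cat_words (decreasing_words a.+1) (increasing_words b.+1) w ->
    size w = (a.+1 + b.+1)%N.
  by move=> [v [sv _] [v' [sv' _] ->]]; rewrite size_cat sv sv'.
(* The corner letter is [x] when [x < y], and [y] when [y < x]. *)
have H1 s (x y : int) t : size s = a -> hook_words a.+1 b.+1 (s ++ [:: x, y & t]) <->
    [/\ size t = b, sorted >%R (rcons s x), path <%R y t & x < y].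
  move=> sa; rewrite hook_wordsP //=; split=> [[[st] sx /andP[xy yt]]|[st sx yt xy]] //.
  by split; rewrite ?st ?xy.
have H2 s (x y : int) t : size s = a -> hook_words a.+2 b (s ++ [:: x, y & t]) <->
    [/\ size t = b, sorted >%R (rcons s x), path <%R y t & y < x].
  move=> sa; rewrite -cat_rcons hook_wordsP ?size_rcons ?sa //.
  rewrite -[rcons (rcons s x) y]cats1 cat_rcons sorted_cat_cons /= andbT.
  by split=> [[st /andP[sx xy] yt]|[st sx yt xy]] //; split; rewrite ?sx.
rewrite (@word_sumM _ _ a.+1 b.+1) => [|w []//|w []//].
apply: (word_sum_split Cs) => w.
- move=> Hw; have [|s [x [y [t [sa E]]]]] := @split_nth_word a b w; first by case: Hw.
  by move: Hw; rewrite E H1 // cat_hook_words // => -[].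
- move=> Hw; have [|s [x [y [t [sa E]]]]] := @split_nth_word a b w.
    by case: Hw => ->; rewrite addnS.
  by move: Hw; rewrite E H2 // cat_hook_words // => -[].
- move=> Hw; have [|s [x [y [t [sa E]]]]] := @split_nth_word a b w; first by case: Hw.
  move: Hw; rewrite E H1 // H2 // => -[_ _ _ xy] [_ _ _ yx].
  by have := lt_trans xy yx; rewrite ltxx.
- move=> Cw; have [s [x [y [t [sa E]]]]] := split_nth_word (Cs w Cw).
  move: Cw; rewrite E cat_hook_words // H1 // H2 // => -[st sx yt].
  (* Equal junction letters put the square of an operator into the product. *)
  case: (ltgtP x y) => [xy|xy|<-] n1 n2; last exact: u_word_sq.
    by case: n1.
  by case: n2.
Qed.

(** [h_op] multiplies the operators of an increasing sequence in reverse order, so [rev] is the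
    reindexing bijection. *)
Lemma h_op_word_sum (m : nat) : h_op R n m = word_sum (decreasing_words m).
Proof.
apply/esym/(reindex_op_sum (g := rev)).
split=> [w [sw ws]|w w' _ _ /(can_inj revK) //|w [sw ws]].
  by split; rewrite ?size_rev // rev_sorted.
exists (rev w); rewrite ?revK //; split; rewrite ?size_rev //.
by rewrite rev_sorted.
Qed.

Lemma h_op0 : h_op R n 0 = 1.
Proof.
rewrite (h_op_word_sum 0) -[RHS](_ : u_word R n [::] = 1); last by rewrite /u_word big_nil.
rewrite -word_sum1; congr word_sum; apply/seteqP.
by split=> w /= [] => [/size0nil ->|->].
Qed.

Lemma hook_words0 a : hook_words a.+1 0 = decreasing_words a.+1.
Proof.
apply/seteqP; split=> w /= => [[]|[sw dw]]; first rewrite addn0 => sw.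
  by rewrite take_oversize ?sw.
rewrite /hook_words /= addn0 take_oversize ?sw //; split=> //.
(* Only the corner letter is left, so the increasing condition is vacuous. *)
have : size (drop a w) = 1%N by rewrite size_drop sw; lia.
by case: (drop a w) => [|x []].
Qed.

Lemma hook_words1 b : hook_words 1 b = increasing_words b.+1.
Proof.
apply/seteqP; split=> w /=; rewrite /hook_words /increasing_words /= drop0 add1n.
  by case.
by case=> sw iw; split=> //; case: w {sw iw} => //= x w; rewrite take0.
Qed.

(** Induction on [b] for all [a] at once: the expansion leads to hooks with [b] boxes below the
    corner and first row of length [a.+2] or 1. *)
Lemma det_jacobi_trudi_hook_op a b :
  \det (jacobi_trudi_hook (h_op R n) (fun j => h_op R n (a.+1 + j)%N%:Z) b) =
  word_sum (hook_words a.+1 b).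
Proof.
elim: b a => [|b IH] a.
  by rewrite det_jacobi_trudi_hook0 addn0 h_op_word_sum hook_words0.
rewrite det_jacobi_trudi_hookS; [|exact: h_op0|by case].
rewrite [(fun j => _) \o S](_ : _ = fun j => h_op R n (a.+2 + j)%N%:Z); last first.
  by apply: funext => j /=; rewrite -addSnnS.
rewrite IH addn0; apply/eqP; rewrite subr_eq -word_sum_hookS; apply/eqP.
rewrite [(fun j => h_op R n j.+1)](_ : _ = fun j => h_op R n (1 + j)%N%:Z); last first.
  by apply: funext => j; rewrite add1n.
by rewrite IH h_op_word_sum hook_words1.
Qed.

(** * Hook words as reading words of fillings *)

Definition hook_filling_of_word a (w : seq int) : filling :=
  rev (take a w) :: [seq [:: i] | i <- drop a w].

Lemma reading_hook_filling_of_word a w : reading (hook_filling_of_word a w) = w.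
Proof.
rewrite /reading /= revK -map_comp (eq_map (g := fun i => [:: i])) //.
by rewrite flatten_seq1 cat_take_drop.
Qed.

Lemma hook_filling_of_word_cat a s (x : int) t : size s = a ->
  hook_filling_of_word a.+1 (s ++ x :: t) = (x :: rev s) :: [seq [:: i] | i <- t].
Proof.
move=> sa; rewrite /hook_filling_of_word -cat_rcons.
by rewrite take_size_cat ?drop_size_cat ?size_rcons ?sa // rev_rcons.
Qed.

(** Injectivity comes from reading the word back. The corner letter starts both the row and the
    column, so the two monotonicity conditions correspond. *)
Lemma hook_filling_of_word_bij a b lam : parts lam = a.+1 :: nseq b 1%N ->
  set_bij (hook_words a.+1 b) [set T | hook_filling lam T] (hook_filling_of_word a.+1).
Proof.
move=> lamE; split=> [w Hw|w w' _ _ ww'|T [shT rT cT]] /=.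
- have sw : size w = (a.+1 + b)%N by case: Hw.
  have [s [x [t [sa E]]]] : exists s x t, size s = a /\ w = s ++ x :: t.
    exists (take a w), (nth 0 w a), (drop a.+1 w).
    by rewrite size_takel -?drop_nth ?cat_take_drop ?sw //; lia.
  move: Hw; rewrite E hook_wordsP // hook_filling_of_word_cat // => -[st sx xt].
  split=> /=.
  + rewrite lamE /= size_rev sa /shape -map_comp -st; congr (_ :: _).
    by elim: (t) => //= ? ? ->.
  + by rewrite -[path _ _ _]/(sorted <%R (x :: rev s)) -rev_rcons rev_sorted.
  + by rewrite -map_comp map_id.
- by rewrite -(reading_hook_filling_of_word a.+1 w) ww' reading_hook_filling_of_word.
- case: T shT rT cT => [|r rows]; rewrite lamE //= => -[sr srows] + cT.
  case: r sr cT => //= x r [sr] cT rT.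
  (* Rows below the first have a single box, so their heads determine them. *)
  have rowsE : rows = [seq [:: i] | i <- [seq head 0 row | row <- rows]].
    elim: rows b srows {cT lamE} => //= row rows IH [//|b] [srow srows].
    by rewrite -(IH b srows); case: row srow => // i [].
  (* The witness is the reading word of the filling: top row backwards down to the corner [x], then
     the rest of the column. *)
  exists (rev r ++ x :: [seq head 0 row | row <- rows]).
    rewrite hook_wordsP ?size_rev //; split=> //.
      by rewrite size_map -[RHS](size_nseq b 1%N) -srows size_map.
    by rewrite -rev_cons rev_sorted.
  by rewrite hook_filling_of_word_cat ?size_rev // revK -rowsE.
Qed.
End RibbonOperators.

Theorem theorem7p3 (R : realType) (n : nat) (lam : intpart) (a b : nat)
  (hn : (1 <= n)%N) (ha : (1 <= a)%N) (hlam : parts lam = a :: nseq b 1%N) :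
  schur_op R n lam
  = op_sum [set T : filling | hook_filling lam T]%classic
      (fun T => u_word R n (reading T)).
Proof.
case: a ha hlam => // a _ hlam.
rewrite (reindex_op_sum _ (hook_filling_of_word_bij hlam)).
rewrite (_ : _ \o _ = u_word R n); last first.
  by apply: funext => w /=; rewrite reading_hook_filling_of_word.
rewrite -[RHS]det_jacobi_trudi_hook_op /schur_op hlam /= size_nseq.
congr (\det _); apply/matrixP=> i j; rewrite !mxE.
(* The first part is [a.+1] and all later ones are 1, as in [jacobi_trudi_hook]. *)
case: eqVneq => [->|]; first by rewrite (_ : _ + j%:Z = (a.+1 + j)%N%:Z) //= subr0.
by case: i => -[|i] // lt_i _ /=; rewrite nth_nseq ifT.
Qed.
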